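(* Let $n\ge1$, let $\vec\epsilon=(\epsilon_1,\dots,\epsilon_n)$ with $0\le\epsilon_i\le\tfrac12$ for all $i$, and let $f:\{0,1\}^n\to\mathbb{R}$ be nonnegative and not identically zero. (i) For every integer $q\ge2$, \[ \ln \|T_{\vec\epsilon} f\|_q ~\le~ \mathbb{E}_{T \sim \vec\lambda}\, \ln \| \mathbb{E}(f|T)\|_q, \qquad \lambda_i = 1 + \frac{1}{q-1}\log_2\!\big(\epsilon_i^q + (1-\epsilon_i)^q\big). \] (ii) Also \[ \ln \|T_{\vec\epsilon} f\|_{\infty} ~\le~ \mathbb{E}_{T \sim \vec\lambda}\, \ln \| \mathbb{E}(f|T)\|_{\infty}, \qquad \lambda_i = 1 + \log_2(1-\epsilon_i). \] (iii) Both inequalities hold with equality whenever $f$ is the characteristic function of a (nonempty) subcube of $\{0,1\}^n$.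
   Context: Norms are with respect to the uniform probability measure on $\{0,1\}^n$: $\|g\|_q=(\mathbb{E}_x |g(x)|^q)^{1/q}$, $\|g\|_\infty=\max_x|g(x)|$. For $\vec\epsilon=(\epsilon_1,\dots,\epsilon_n)\in[0,\tfrac12]^n$, the operator $T_{\vec\epsilon}$ is defined by $(T_{\vec\epsilon}f)(x)=\mathbb{E}f(y)$, where $y$ is random with $y_i=x_i$ with probability $1-\epsilon_i$ and $y_i=1-x_i$ with probability $\epsilon_i$, independently over $i$. For $\vec\lambda=(\lambda_1,\dots,\lambda_n)\in[0,1]^n$, $T\sim\vec\lambda$ denotes a random subset of $[n]$ containing each $i$ independently with probability $\lambda_i$. For $T\subseteq[n]$, $\mathbb{E}(f|T)(x)=\mathbb{E}_{y:\,y|_T=x|_T} f(y)$ (uniform average over $y$ agreeing with $x$ on $T$). A subcube is a set $\{x\in\{0,1\}^n: x_i=a_i \ \forall i\in K\}$ for some $K\subseteq[n]$, $a\in\{0,1\}^K$. *)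

(* Defs.v *)
From mathcomp Require Import all_boot all_order all_algebra.
From mathcomp Require Import reals exp.
Set Implicit Arguments. Unset Strict Implicit. Unset Printing Implicit Defensive.
Import Order.TTheory GRing.Theory Num.Theory.
Local Open Scope ring_scope.

Definition cube (n : nat) := {ffun 'I_n -> bool}.

Section Defs.
Variable R : realType.
Variable n : nat.

Definition Eu (g : cube n -> R) : R :=
  (#|{: cube n}|%:R)^-1 * \sum_(x : cube n) g x.

Definition qnorm (q : nat) (g : cube n -> R) : R :=
  powR (Eu (fun x => `|g x| ^+ q)) (q%:R^-1).

Definition infnorm (g : cube n -> R) : R :=
  \big[Num.max/0]_(x : cube n) `|g x|.

Definition noise (eps : 'I_n -> R) (f : cube n -> R) (x : cube n) : R :=
  \sum_(y : cube n)
     (\prod_(i < n) (if y i == x i then 1 - eps i else eps i)) * f y.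

Definition condE (T : {set 'I_n}) (f : cube n -> R) (x : cube n) : R :=
  (#|[set y : cube n | [forall i in T, y i == x i]]|%:R)^-1 *
  \sum_(y : cube n | [forall i in T, y i == x i]) f y.

Definition Erand (lam : 'I_n -> R) (F : {set 'I_n} -> R) : R :=
  \sum_(T : {set 'I_n})
     (\prod_(i in T) lam i * \prod_(i in ~: T) (1 - lam i)) * F T.

Definition subcube_ind (K : {set 'I_n}) (a : cube n) (x : cube n) : R :=
  if [forall i in K, x i == a i] then 1 else 0.

End Defs.

Definition log2 {R : realType} (x : R) : R := ln x / ln 2.

Definition lam_q {R : realType} (q : nat) (e : R) : R :=
  1 + (q.-1%:R)^-1 * log2 (e ^+ q + (1 - e) ^+ q).

Definition lam_inf {R : realType} (e : R) : R := 1 + log2 (1 - e).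

(* Main.v *)
Require Import Defs.
From mathcomp Require Import all_boot all_order all_algebra.
From mathcomp Require Import ring lra.
From mathcomp Require Import boolp functions.
From mathcomp Require Import interval_inference reals topology normedtype sequences derive realfun convex exp.
Import Order.TTheory GRing.Theory Num.Theory.
Local Open Scope ring_scope.

(* Noise with parameter 0 in a coordinate does nothing and noise with parameter
   1/2 averages that coordinate out, so E(f|T) is itself a noisy version of f.
   Hence it suffices to treat one coordinate i: with T_i, E_i the noise and the
   averaging there, show ||T_i g|| <= ||g||^lambda_i * ||E_i g||^(1 - lambda_i)
   for nonnegative g, and replace the coordinates one at a time.

   For q-norms, pair x with its flip in coordinate i. By Hoelder's inequality it
   is enough to have the bound for functions on two points, which after scaling
   the values to 1 + u, 1 - u reads  P(uv) <= P(u)^lambda(v)  where v = 1 - 2 eps,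
   P(u) = ((1+u)^q + (1-u)^q) / 2 and lambda(v) = ln P(v) / ln P(1). Both sides
   agree at u = 0 and u = 1, so by the mean value theorem the inequality follows
   once Q(uv)/Q(u) is nondecreasing in u, where Q = P'/P. This says that
   1 + u Q'/Q is nonincreasing, and with a = 1 + u, b = 1 - u, m = q - 1,
   1 + u Q'/Q = (4 m u (ab)^(m-1) / (a^m - b^m) + a^m + b^m) / (a^q + b^q),
   in which the monotonicity is visible.

   For the maximum norm, T_i g = v g + (1 - v) E_i g and the bound is the chord
   inequality for t^lambda on [1, 2].

   For a subcube, noisy versions of the indicator are either independent of
   coordinate i or vanish on one side of it; the one-coordinate inequality is
   then an equality. *)

(** * Even and odd parts of powers of 1 + u, and monotonicity of their ratios *)

Section PowerSums.
Set Implicit Arguments.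
Unset Strict Implicit.
Import numFieldNormedType.Exports.
Context {R : realType}.
Implicit Types (u v s t : R) (k m : nat).

(** [psum q] is 2P. The two functions are twice the even and odd parts of (1 + u)^k, which gives the
    coupled recursion used in the inductions below. *)
Definition psum k u := (1 + u) ^+ k + (1 - u) ^+ k.
Definition pdiff k u := (1 + u) ^+ k - (1 - u) ^+ k.

Lemma psumS k u : psum k.+1 u = psum k u + u * pdiff k u.
Proof. by rewrite /psum /pdiff !exprS; ring. Qed.

Lemma pdiffS k u : pdiff k.+1 u = pdiff k u + u * psum k u.
Proof. by rewrite /psum /pdiff !exprS; ring. Qed.

Lemma psum0r k : psum k 0 = 2.
Proof. by rewrite /psum addr0 subr0 expr1n. Qed.

Lemma psum1r k : psum k.+1 1 = 2 ^+ k.+1.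
Proof. by rewrite /psum subrr expr0n addr0. Qed.

Lemma psum_gt0 k u : 0 <= u <= 1 -> 0 < psum k u.
Proof.
move=> /andP[u0 u1]; apply: ltr_pwDl; first by apply: exprn_gt0; lra.
by apply: exprn_ge0; lra.
Qed.

Lemma pdiff_gt0 k u : 0 < u <= 1 -> 0 < pdiff k.+1 u.
Proof. by move=> /andP[u0 u1]; rewrite subr_gt0 ltrXn2r//; lra. Qed.

Lemma pdiff_ge0 k u : 0 <= u <= 1 -> 0 <= pdiff k u.
Proof. by move=> /andP[u0 u1]; rewrite subr_ge0 lerXn2r ?nnegrE//; lra. Qed.

(** The induction treats both functions together: in [psumS] and [pdiffS] each grows by u times the
    other. *)
Lemma psum_pdiff_homo k s t : 0 <= s -> s <= t -> t <= 1 ->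
  psum k s <= psum k t /\ pdiff k s <= pdiff k t.
Proof.
move=> s0 st t1; elim: k => [|k [IHs IHd]]; first by rewrite /psum /pdiff !expr0.
have s1 : 0 <= s <= 1 by rewrite s0 (le_trans st).
rewrite psumS pdiffS psumS pdiffS.
have := pdiff_ge0 k s1; have := psum_gt0 k s1 => hs hd.
by split; apply: lerD => //; apply: ler_pM => //; exact: ltW.
Qed.

(** Division-free monotonicity of [pdiff k u / u]: by [pdiffS], raising k adds the nondecreasing
    [psum k u] to this quotient. *)
Lemma pdiff_div_homo k s t : 0 <= s -> s <= t -> t <= 1 ->
  t * pdiff k s <= s * pdiff k t.
Proof.
move=> s0 st t1; elim: k => [|k IH]; first by rewrite /pdiff !expr0 !subrr !mulr0.
have [IHs _] := psum_pdiff_homo k s0 st t1.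
rewrite !pdiffS !(mulrDr _ (pdiff k _)); apply: lerD => //.
by rewrite !mulrA (mulrC t) ler_wpM2l// mulr_ge0// (le_trans s0).
Qed.

(** The cross-multiplied difference is governed by the k-th powers of (1 + t)(1 - s) and (1 + s)(1 -
    t), and the first base exceeds the second by 2(t - s). *)
Lemma pdiff_psum_homo k s t : 0 <= s -> s <= t -> t <= 1 ->
  pdiff k s * psum k t <= pdiff k t * psum k s.
Proof.
move=> s0 st t1; rewrite -subr_ge0.
have -> : pdiff k t * psum k s - pdiff k s * psum k t =
  2 * ((1 + t) ^+ k * (1 - s) ^+ k - (1 + s) ^+ k * (1 - t) ^+ k).
  by rewrite /psum /pdiff; ring.
rewrite mulr_ge0// subr_ge0 -!exprMn lerXn2r ?nnegrE//; nra.
Qed.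

(** This is Q'/Q. From here on q is [m.+2], so the index [m] is q - 2, not q - 1. *)
Definition dlnratio m u :=
  m.+1%:R * psum m u / pdiff m.+1 u - m.+2%:R * pdiff m.+1 u / psum m.+2 u.

(** In this form every factor of the first summand that depends on u is nonincreasing, and the
    second summand is the reciprocal of a nondecreasing function. *)
Lemma dlnratioE m u : 0 < u < 1 ->
  1 + u * dlnratio m u =
  4 * m.+1%:R * (u / pdiff m.+1 u) * (1 - u ^+ 2) ^+ m / psum m.+2 u
  + (1 + u * (pdiff m.+1 u / psum m.+1 u))^-1.
Proof.
move=> /andP[u0 u1].
have h1 : 0 < u <= 1 by lra.
have h0 : 0 <= u <= 1 by lra.
have hA := pdiff_gt0 m h1; have hB := psum_gt0 m.+2 h0.
have hB1 := psum_gt0 m.+1 h0.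
(* With a = 1 + u and b = 1 - u, the difference of the two products is (ab)^m (a + b)^2, and a + b =
   2. *)
have E : psum m u * psum m.+2 u = pdiff m.+1 u ^+ 2 + 4 * (1 - u ^+ 2) ^+ m.
  have -> : 1 - u ^+ 2 = (1 + u) * (1 - u) by ring.
  by rewrite exprMn /psum /pdiff !exprS; ring.
have D : 1 + u * (pdiff m.+1 u / psum m.+1 u) = psum m.+2 u / psum m.+1 u.
  by rewrite (psumS m.+1); field; rewrite gt_eqF.
rewrite D /dlnratio.
have -> : 4 * m.+1%:R * (u / pdiff m.+1 u) * (1 - u ^+ 2) ^+ m =
   m.+1%:R * (u / pdiff m.+1 u) * (psum m u * psum m.+2 u - pdiff m.+1 u ^+ 2).
  by rewrite E; ring.
have -> : psum m.+1 u = psum m.+2 u - u * pdiff m.+1 u by rewrite (psumS m.+1) addrK.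
rewrite [in X in _ - X / _](_ : m.+2%:R = 1 + m.+1%:R); last by rewrite -natr1 addrC.
field; rewrite !gt_eqF//=.
by rewrite (psumS m.+1) addrK.
Qed.

Lemma dlnratio_nincr m s t : 0 < s -> s <= t -> t < 1 ->
  t * dlnratio m t <= s * dlnratio m s.
Proof.
move=> s0 st t1.
have hs : 0 < s < 1 by lra.
have ht : 0 < t < 1 by lra.
have hs1 : 0 < s <= 1 by lra.
have ht1 : 0 < t <= 1 by lra.
have hs2 : 0 <= s <= 1 by lra.
have ht2 : 0 <= t <= 1 by lra.
have s0' := ltW s0; have t1' := ltW t1.
rewrite -(lerD2l 1) !dlnratioE//; apply: lerD; last first.
  rewrite lef_pV2 ?posrE; last 2 first.
  - by rewrite ltr_pwDl// mulr_ge0 ?divr_ge0 ?pdiff_ge0 ?ltW ?psum_gt0//; lra.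
  - by rewrite ltr_pwDl// mulr_ge0 ?divr_ge0 ?pdiff_ge0 ?ltW ?psum_gt0//; lra.
  rewrite lerD2l; apply: ler_pM => //; rewrite ?divr_ge0 ?pdiff_ge0 ?(ltW (psum_gt0 _ _))//.
  by rewrite ler_pdivrMr ?psum_gt0// mulrAC ler_pdivlMr ?psum_gt0// pdiff_psum_homo.
have [hB _] := psum_pdiff_homo m.+2 s0' st t1'.
have hsq : 0 <= 1 - t ^+ 2 <= 1 - s ^+ 2 by apply/andP; split; nra.
rewrite -!mulrA !ler_wpM2l// !mulrA; apply: ler_pM.
- by rewrite mulr_ge0 ?divr_ge0 ?exprn_ge0 ?(ltW (pdiff_gt0 _ _))//; lra.
- by rewrite invr_ge0 ltW ?psum_gt0.
- apply: ler_pM; rewrite ?divr_ge0 ?exprn_ge0 ?(ltW (pdiff_gt0 _ _))//; try lra.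
    by rewrite ler_pdivrMr ?pdiff_gt0// mulrAC ler_pdivlMr ?pdiff_gt0// pdiff_div_homo.
  by rewrite lerXn2r ?nnegrE//; lra.
by rewrite lef_pV2 ?posrE ?psum_gt0.
Qed.

Lemma is_derive_psum k u : is_derive u 1 (psum k) (k%:R * pdiff k.-1 u).
Proof.
(* Written with operations on functions, so that instance inference can compute the derivative. *)
have -> : psum k = ((cst 1 + id) ^+ k + (cst 1 - id) ^+ k) :> (R -> R).
  by apply/funext => x; rewrite /psum !fctE.
apply: is_derive_eq; rewrite /pdiff !fctE /GRing.scale/=; ring.
Qed.

Lemma is_derive_pdiff k u : is_derive u 1 (pdiff k) (k%:R * psum k.-1 u).
Proof.
have -> : pdiff k = ((cst 1 + id) ^+ k - (cst 1 - id) ^+ k) :> (R -> R).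
  by apply/funext => x; rewrite /pdiff !fctE.
apply: is_derive_eq; rewrite /psum !fctE /GRing.scale/=; ring.
Qed.

End PowerSums.

(** * Mean value theorem and chain rules *)

Section Calculus.
Set Implicit Arguments.
Unset Strict Implicit.
Import numFieldNormedType.Exports.
Context {R : realType}.
Implicit Types (f df : R -> R) (a b v x y : R).

Lemma MVT_is_derive f df a b : a < b ->
  (forall x, a <= x <= b -> is_derive x 1 f (df x)) ->
  exists2 c, a < c < b & f b - f a = df c * (b - a).
Proof.
move=> ab fd.
have [||c + ->] := @MVT R f df a b ab.
- by move=> x; rewrite in_itv/= => /andP[ax xb]; apply: fd; rewrite !ltW.
- apply: derivable_within_continuous => x; rewrite in_itv/= => /fd h.
  exact: ex_derive.
- by rewrite in_itv/= => cab; exists c.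
Qed.

Lemma is_derive_ln_comp f df x : is_derive x 1 f (df x) -> 0 < f x ->
  is_derive x 1 (fun x => ln (f x)) (df x / f x).
Proof.
move=> fd fx; rewrite mulrC.
by apply: (@is_derive1_comp R (@ln R) f); exact: is_derive1_ln.
Qed.

Lemma is_derive_dilate f df v x : is_derive (v * x) 1 f (df (v * x)) ->
  is_derive x 1 (fun x => f (v * x)) (v * df (v * x)).
Proof.
move=> fd; rewrite mulrC; apply: (@is_derive1_comp R f ( *%R v)) => //.
have -> : *%R v = v \*: id by apply/funext.
by apply: is_derive_eq; rewrite scaler1.
Qed.

End Calculus.

(** * The two-point inequality in logarithmic form *)

Section TwoPoint.
Set Implicit Arguments.
Unset Strict Implicit.
Import numFieldNormedType.Exports.
Context {R : realType}.
Implicit Types (u v s t : R) (k m : nat).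

(** This is ln Q up to the additive constant ln q. *)
Definition lnratio m u := ln (pdiff m.+1 u) - ln (psum m.+2 u).

Lemma is_derive_lnratio m u : 0 < u < 1 ->
  is_derive u 1 (@lnratio m) (dlnratio m u).
Proof.
move=> /andP[u0 u1]; apply: is_deriveB.
  apply: (@is_derive_ln_comp _ _ (fun u => m.+1%:R * psum m u)).
    exact: is_derive_pdiff.
  by apply: pdiff_gt0; lra.
apply: (@is_derive_ln_comp _ _ (fun u => m.+2%:R * pdiff m.+1 u)).
  exact: is_derive_psum.
by apply: psum_gt0; lra.
Qed.

(** Multiplied by u, the derivative of the difference compares x Q'(x)/Q(x) at x = vu and at x = u,
    so [dlnratio_nincr] gives its sign. *)
Lemma lnratio_dilate_homo m v s t : 0 < v <= 1 -> 0 < s -> s < t -> t < 1 ->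
  lnratio m (v * s) - lnratio m s <= lnratio m (v * t) - lnratio m t.
Proof.
move=> /andP[v0 v1] s0 st t1.
have [x|c /andP[sc ct] E] := @MVT_is_derive _
  (fun u => lnratio m (v * u) - lnratio m u)
  (fun u => v * dlnratio m (v * u) - dlnratio m u) s t st.
  move=> /andP[sx xt]; apply: is_deriveB.
    by apply: is_derive_dilate; apply: is_derive_lnratio; nra.
  by apply: is_derive_lnratio; lra.
rewrite -subr_ge0 E mulr_ge0 ?subr_ge0 ?(ltW st)//.
have c0 : 0 < c by lra.
rewrite -(ler_pM2l c0) mulrA (mulrC c v).
by apply: dlnratio_nincr; nra.
Qed.

Lemma pdiff_psum_dilate m v s t : 0 < v <= 1 -> 0 < s -> s < t -> t < 1 ->
  (pdiff m.+1 (v * s) / psum m.+2 (v * s)) * (pdiff m.+1 t / psum m.+2 t) <=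
  (pdiff m.+1 (v * t) / psum m.+2 (v * t)) * (pdiff m.+1 s / psum m.+2 s).
Proof.
move=> hv s0 st t1; have := lnratio_dilate_homo m hv s0 st t1.
have /andP[v0 v1] := hv.
have pos (u : R) : 0 < u < 1 -> 0 < pdiff m.+1 u / psum m.+2 u.
  by move=> /andP[u0 u1]; rewrite divr_gt0 ?pdiff_gt0 ?psum_gt0//; lra.
have lnE u : 0 < u < 1 -> lnratio m u = ln (pdiff m.+1 u / psum m.+2 u).
  by move=> /andP[u0 u1]; rewrite ln_div ?posrE ?pdiff_gt0 ?psum_gt0//; lra.
have h1 : 0 < v * s < 1 by apply/andP; split; nra.
have h2 : 0 < v * t < 1 by apply/andP; split; nra.
have h3 : 0 < s < 1 by lra.
have h4 : 0 < t < 1 by lra.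
rewrite !lnE// lerBlDr addrAC lerBrDr -!lnM ?posrE ?pos//.
by rewrite ler_ln ?posrE ?(mulr_gt0 (pos _ _) (pos _ _)).
Qed.

Definition lnpsum m u := ln (psum m u) - ln 2.

Lemma lnpsum1 m : lnpsum m.+2 1 = m.+1%:R * ln 2 :> R.
Proof. by rewrite /lnpsum psum1r lnXn// mulrSr addrK mulr_natl. Qed.

(* [lnpsum q u] is [ln P(u)], so this is [P(uv) <= P(u) ^ lambda(v)]. *)
Lemma lnpsum_dilate m v u : 0 <= v <= 1 -> 0 <= u <= 1 ->
  m.+1%:R * ln 2 * lnpsum m.+2 (v * u) <= lnpsum m.+2 v * lnpsum m.+2 u.
Proof.
move=> /andP[v0 v1] /andP[u0 u1].
have P0 : lnpsum m.+2 0 = 0 :> R by rewrite /lnpsum psum0r subrr.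
have [->|vn0] := eqVneq v 0; first by rewrite !(mul0r,P0,mulr0).
have vp : 0 < v <= 1 by rewrite lt_neqAle eq_sym vn0 v0.
have [->|un0] := eqVneq u 0; first by rewrite !(mul0r,P0,mulr0).
have [->|un1] := eqVneq u 1; first by rewrite !(mulr1, lnpsum1) mulrC.
have up : 0 < u < 1 by rewrite !lt_neqAle eq_sym un0 u0 un1.
have ln2p : 0 < m.+1%:R * ln 2 :> R by rewrite mulr_gt0 ?ln_gt0 ?ltr1n.
(* Here [c] is lambda(v), and [F] is the logarithm of P(x)^lambda(v) / P(vx), which vanishes at 0
   and at 1. *)
pose c := lnpsum m.+2 v / (m.+1%:R * ln 2).
pose F (x : R) := c * lnpsum m.+2 x - lnpsum m.+2 (v * x).
suff F0 : 0 <= F u.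
  move: F0; rewrite /F /c subr_ge0 mulrAC ler_pdivlMr//.
  by rewrite mulrC (mulrC (lnpsum _ _)) (mulrC (lnpsum _ u)).
pose Q (x : R) := m.+2%:R * pdiff m.+1 x / psum m.+2 x.
have dF (x : R) : 0 <= x <= 1 -> is_derive x 1 F (c * Q x - v * Q (v * x)).
  have dP (y : R) : 0 <= y <= 1 -> is_derive y 1 (lnpsum m.+2) (Q y).
    move=> hy; rewrite -[Q y]subr0; apply: is_deriveB.
    apply: (@is_derive_ln_comp _ _ (fun u => m.+2%:R * pdiff m.+1 u)).
      exact: is_derive_psum.
    exact: psum_gt0.
  move=> hx; apply: is_deriveB.
    by have := dP x hx => h; apply: is_deriveZ.
  by apply: is_derive_dilate; apply: dP; nra.
have F00 : F 0 = 0 by rewrite /F mulr0 P0 mulr0 subrr.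
have F11 : F 1 = 0 by rewrite /F mulr1 lnpsum1 /c divfK ?subrr// gt_eqF.
(* If F(u) < 0, the mean value theorem on [0, u] and [u, 1] gives s < u < t with F'(s) < 0 < F'(t).
   Then v Q(vs)/Q(s) > c > v Q(vt)/Q(t), against the monotonicity of Q(vx)/Q(x). *)
rewrite leNgt; apply/negP => Fu.
have /andP[u0' u1'] := up.
have [|s /andP[s0 su] Es] := @MVT_is_derive _ F (fun x => c * Q x - v * Q (v * x)) _ _ u0'.
  by move=> x /andP[x0 xu]; apply: dF; lra.
have [|t /andP[ut t1] Et] := @MVT_is_derive _ F (fun x => c * Q x - v * Q (v * x)) _ _ u1'.
  by move=> x /andP[x0 xu]; apply: dF; lra.
have ds : c * Q s - v * Q (v * s) < 0.
  by rewrite -(pmulr_llt0 _ (_ : 0 < u - 0)) ?subr_gt0// -Es F00 subr0.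
have dt : 0 < c * Q t - v * Q (v * t).
  by rewrite -(pmulr_lgt0 _ (_ : 0 < 1 - u)) ?subr_gt0// -Et F11 sub0r oppr_gt0.
have pos (x : R) : 0 < x < 1 -> 0 < Q x.
  by move=> /andP[x0 x1]; rewrite divr_gt0 ?mulr_gt0 ?pdiff_gt0 ?psum_gt0//; lra.
have Qs : 0 < Q s by apply: pos; lra.
have Qt : 0 < Q t by apply: pos; lra.
have : v * Q (v * s) * Q t <= v * Q (v * t) * Q s.
  have QE x : Q x = m.+2%:R * (pdiff m.+1 x / psum m.+2 x) by rewrite /Q mulrA.
  rewrite -!(mulrA v) ler_wpM2l// !QE mulrACA [leRHS]mulrACA ler_wpM2l ?mulr_ge0//.
    by apply: pdiff_psum_dilate => //; lra.
nra.
Qed.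

End TwoPoint.

(** * Hoelder's inequality and the chord inequality, in logarithmic form *)

Section Convexity.
Set Implicit Arguments.
Unset Strict Implicit.
Context {R : realType}.
Implicit Types (l x y e M N : R).

Lemma expR_ln_amgm l x y : 0 <= l <= 1 -> 0 < x -> 0 < y ->
  expR (l * ln x + (1 - l) * ln y) <= l * x + (1 - l) * y.
Proof.
move=> /andP[l0 l1] x0 y0.
have := convex_expR (Itv01 l0 l1) (ln x) (ln y).
by rewrite !convRE/= !lnK.
Qed.

(** The logarithmic bound is assumed only where [L i] is positive, since [ln] takes the default
    value 0 at 0. *)
Lemma ln_sum_holder (I : finType) (L a b : I -> R) l : 0 <= l <= 1 ->
  (forall i, 0 <= L i) -> (forall i, 0 <= a i) -> (forall i, 0 <= b i) ->
  (forall i, 0 < L i ->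
    [/\ 0 < a i, 0 < b i & ln (L i) <= l * ln (a i) + (1 - l) * ln (b i)]) ->
  0 < \sum_i L i ->
  ln (\sum_i L i) <= l * ln (\sum_i a i) + (1 - l) * ln (\sum_i b i).
Proof.
move=> hl L0 a0 b0 h S0; have /andP[l0 l1] := hl.
have [i Li] : exists i, 0 < L i.
  apply/existsP; rewrite -[X in is_true X]negbK; apply/negP => /existsPn hn.
  move: S0; rewrite big1 ?ltxx// => i _; apply/eqP.
  by rewrite eq_le L0 andbT leNgt hn.
have [ai bi _] := h i Li.
have A0 : 0 < \sum_i a i.
  by rewrite (bigD1 i)//= ltr_pwDl// sumr_ge0.
have B0 : 0 < \sum_i b i.
  by rewrite (bigD1 i)//= ltr_pwDl// sumr_ge0.
set A := \sum_i a i in A0 *; set B := \sum_i b i in B0 *.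
set K := l * ln A + (1 - l) * ln B.
rewrite -[leRHS]expRK ler_ln ?posrE ?expR_gt0//.
(* The normalized terms [a j / A] and [b j / B] each sum to 1, so weighted AM-GM term by term is
   enough. *)
have -> : expR K = \sum_j expR K * (l * (a j / A) + (1 - l) * (b j / B)).
  rewrite -mulr_sumr big_split/= -!mulr_sumr -!mulr_suml !divff ?gt_eqF//.
  by rewrite !mulr1 addrC subrK mulr1.
apply: ler_sum => j _; have [Lj|Lj] := ltP 0 (L j); last first.
  rewrite (le_trans Lj)// mulr_ge0 ?expR_ge0// addr_ge0// mulr_ge0 ?subr_ge0//.
    by rewrite divr_ge0// ltW.
  by rewrite divr_ge0// ltW.
have [aj bj hj] := h j Lj.
rewrite mulrC -ler_pdivrMr ?expR_gt0// -expRN -[L j](lnK (x := L j)) ?posrE//.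
rewrite -expRD; apply: le_trans (expR_ln_amgm hl _ _); rewrite ?divr_gt0//.
by rewrite ler_expR !ln_div ?posrE//; rewrite /K; lra.
Qed.

(** With v = 1 - 2e this says 2^lambda = 1 + v: the chord of t^lambda on [1, 2] runs from 1 to 1 +
    v. *)
Lemma lam_infE e : e <= 2^-1 -> lam_inf e = ln (1 + (1 - 2 * e)) / ln 2.
Proof.
move=> e1; have -> : 1 + (1 - 2 * e) = 2 * (1 - e) by ring.
have ln2 : ln 2 != 0 :> R by rewrite gt_eqF ?ln_gt0 ?ltr1n.
rewrite /lam_inf /log2 lnM ?posrE//; last lra.
by field.
Qed.

Lemma lam_inf01 e : 0 <= e <= 2^-1 -> 0 <= lam_inf e <= 1.
Proof.
move=> /andP[e0 e1]; have ln2 : 0 < ln 2 :> R by rewrite ln_gt0 ?ltr1n.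
rewrite lam_infE// ler_pdivlMr// ler_pdivrMr// mul0r mul1r ln_ge0/=; last lra.
by rewrite ler_ln ?posrE//; lra.
Qed.

(* The concave function [t ^ lam_inf e] lies above its chord on [1, 2]. *)
Lemma ln_interp_le e M N : 0 <= e <= 2^-1 -> 0 < N -> N <= M <= 2 * N ->
  ln ((1 - 2 * e) * M + 2 * e * N) <= lam_inf e * ln M + (1 - lam_inf e) * ln N.
Proof.
move=> he N0 /andP[NM M2]; have /andP[e0 e1] := he.
have hl := lam_inf01 he; set l := lam_inf e in hl *.
have M0 : 0 < M by lra.
have lam2 : expR (l * ln 2) = 1 + (1 - 2 * e).
  rewrite /l lam_infE// divfK ?gt_eqF ?ln_gt0 ?ltr1n// lnK// posrE; lra.
(* The tangent to t^l at t = M/N bounds c^l from above; it is used at the endpoints c = 1 and c =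
   2. *)
have bound (c : R) : 0 < c ->
    expR (l * ln c) * expR (- (l * ln (M / N))) <= l * (c * N / M) + (1 - l).
  move=> c0; have := @expR_ln_amgm l (c * N / M) 1 hl.
  rewrite ln1 mulr0 addr0 mulr1 => /(_ (divr_gt0 (mulr_gt0 c0 N0) M0) ltr01).
  by apply: le_trans; rewrite -expRD ler_expR !ln_div ?lnM ?posrE ?mulr_gt0//; lra.
have := bound 1 ltr01; have := bound 2 (ltr0Sn _ _).
rewrite lam2 ln1 mulr0 expR0; set X := expR (- _) => h2 h1.
have E : l * ln M + (1 - l) * ln N = ln N + l * ln (M / N).
  by rewrite ln_div ?posrE//; ring.
rewrite E -[l * ln (M / N)]expRK -lnM ?posrE ?expR_gt0//.
have hpos : 0 < (1 - 2 * e) * M + 2 * e * N by nra.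
rewrite ler_ln ?posrE ?mulr_gt0 ?expR_gt0//.
have -> : expR (l * ln (M / N)) = X^-1 by rewrite /X expRN invrK.
rewrite ler_pdivlMr ?expR_gt0//.
(* The weights 2N - M and M - N have sum N and average the endpoints 1 and 2 to M/N, where the
   tangent touches the curve. *)
have EN : (2 * N - M) * (l * (1 * N / M) + (1 - l)) +
          (M - N) * (l * (2 * N / M) + (1 - l)) = N.
  by field; rewrite gt_eqF.
rewrite -[leRHS]EN.
have -> : ((1 - 2 * e) * M + 2 * e * N) * X =
  (2 * N - M) * (1 * X) + (M - N) * ((1 + (1 - 2 * e)) * X) by ring.
by apply: lerD; apply: ler_wpM2l => //; lra.
Qed.

End Convexity.

(** * The two-point inequality in terms of the noise parameter *)

Section TwoPointNorm.
Set Implicit Arguments.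
Unset Strict Implicit.
Context {R : realType}.
Implicit Types (e x y : R) (m : nat).

(** This is lambda(v) = ln P(v) / ln P(1) at v = 1 - 2e, because 1 + v = 2(1 - e) and 1 - v = 2e. *)
Lemma lam_qE m e : 0 <= e <= 2^-1 ->
  lam_q m.+2 e = lnpsum m.+2 (1 - 2 * e) / (m.+1%:R * ln 2).
Proof.
move=> /andP[e0 e1].
have ln2 : ln 2 != 0 :> R by rewrite gt_eqF ?ln_gt0 ?ltr1n.
have E : psum m.+2 (1 - 2 * e) = 2 ^+ m.+2 * (e ^+ m.+2 + (1 - e) ^+ m.+2).
  rewrite /psum mulrDr -!exprMn addrC; congr (_ ^+ _ + _ ^+ _); ring.
have s0 : 0 < e ^+ m.+2 + (1 - e) ^+ m.+2.
  by rewrite ltr_wpDl ?exprn_ge0 ?exprn_gt0//; lra.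
rewrite /lnpsum E lnM ?posrE ?exprn_gt0// lnXn// mulrS.
rewrite -[_ *+ _ as X in ln 2 + X]mulr_natl /lam_q /log2 /=.
by field; rewrite ln2 addrC natr1 pnatr_eq0.
Qed.

(** By [lam_qE] the bounds amount to P(0) <= P(v) <= P(1). *)
Lemma lam_q01 m e : 0 <= e <= 2^-1 -> 0 <= lam_q m.+2 e <= 1.
Proof.
move=> he; have /andP[e0 e1] := he; rewrite lam_qE//.
have v0 : 0 <= 1 - 2 * e by lra.
have v1 : 1 - 2 * e <= 1 by lra.
have ln2p : 0 < m.+1%:R * ln 2 :> R by rewrite mulr_gt0 ?ln_gt0 ?ltr1n.
have [h0 _] := psum_pdiff_homo m.+2 (lexx 0) v0 v1.
have [h1 _] := psum_pdiff_homo m.+2 v0 v1 (lexx 1).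
have pv : 0 < psum m.+2 (1 - 2 * e) by rewrite psum_gt0 ?v0.
rewrite ler_pdivlMr// ler_pdivrMr// mul0r mul1r -lnpsum1 /lnpsum subr_ge0 lerD2r.
have p1 : 0 < psum m.+2 1 :> R by rewrite psum_gt0 ?lexx ?ler01.
by rewrite psum0r in h0; apply/andP; split; rewrite ler_ln ?posrE.
Qed.

Lemma ln_two_point m e x y : 0 <= e <= 2^-1 -> 0 <= x -> 0 <= y -> 0 < x + y ->
  ln (((1 - e) * x + e * y) ^+ m.+2 + ((1 - e) * y + e * x) ^+ m.+2) <=
  lam_q m.+2 e * ln (x ^+ m.+2 + y ^+ m.+2)
  + (1 - lam_q m.+2 e) * ln (2 * ((x + y) / 2) ^+ m.+2).
Proof.
move=> he; wlog yx : x y / y <= x => [hw x0 y0 xy|x0 y0 xy].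
  have [yx|/ltW yx] := leP y x; first exact: hw.
  have := hw y x yx y0 x0; rewrite addrC [X in ln X <= _]addrC [X in _ * ln X + _]addrC.
  exact.
have /andP[e0 e1] := he.
(* The values are N(1 + d) and N(1 - d); noise keeps the mean N and multiplies d by 1 - 2e, so
   [lnpsum_dilate] applies. The assumption y <= x makes d nonnegative. *)
pose N := (x + y) / 2; pose d := (x - y) / (x + y).
have N0 : 0 < N by rewrite divr_gt0.
have xE : x = N * (1 + d) by rewrite /N /d; field; rewrite gt_eqF.
have yE : y = N * (1 - d) by rewrite /N /d; field; rewrite gt_eqF.
have hd : 0 <= d <= 1.
  by rewrite /d divr_ge0 ?subr_ge0 ?(ltW xy)//= ler_pdivrMr//; lra.
have hv : 0 <= 1 - 2 * e <= 1 by lra.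
have hvd : 0 <= (1 - 2 * e) * d <= 1.
  by move: hv hd => /andP[? ?] /andP[? ?]; apply/andP; split; [exact: mulr_ge0|exact: mulr_ile1].
have -> : x ^+ m.+2 + y ^+ m.+2 = N ^+ m.+2 * psum m.+2 d.
  by rewrite xE yE !exprMn /psum mulrDr.
have -> : ((1 - e) * x + e * y) ^+ m.+2 + ((1 - e) * y + e * x) ^+ m.+2 =
    N ^+ m.+2 * psum m.+2 ((1 - 2 * e) * d).
  by rewrite /psum mulrDr -!exprMn xE yE; congr (_ ^+ _ + _ ^+ _); ring.
have Nq : 0 < N ^+ m.+2 by rewrite exprn_gt0.
have lnNM p : 0 < p -> ln (N ^+ m.+2 * p) = ln (N ^+ m.+2) + ln p.
  by move=> p0; rewrite lnM.
rewrite lam_qE// -/N [2 * N ^+ _]mulrC !lnNM ?psum_gt0//.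
have ln2p : 0 < m.+1%:R * ln 2 :> R by rewrite mulr_gt0 ?ln_gt0 ?ltr1n.
have := lnpsum_dilate m hv hd; rewrite mulrC -ler_pdivlMr// mulrAC /lnpsum.
set c := (_ - _) / _; lra.
Qed.

End TwoPointNorm.

(** * Noise in one coordinate, and the replacement of coordinates one at a time *)

Section Cube.
Set Implicit Arguments.
Unset Strict Implicit.
Context {R : realType} {n : nat}.
Implicit Types (eps lam : 'I_n -> R) (f g : cube n -> R) (x y : cube n).
Implicit Types (i j : 'I_n) (T : {set 'I_n}) (e : R).

Definition flip i x : cube n := [ffun j => (j == i) (+) x j].

Lemma flipK i : involutive (flip i).
Proof. by move=> x; apply/ffunP => j; rewrite !ffunE addbA addbb. Qed.

Lemma sum_flip i g : \sum_x g (flip i x) = \sum_x g x.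
Proof. by rewrite [RHS](reindex_inj (inv_inj (flipK i))). Qed.

Definition upd eps i e j := if j == i then e else eps j.

Definition noise1 i e g x := (1 - e) * g x + e * g (flip i x).

(** The kernel is a product over coordinates, so only its factor at [i] has to be compared. *)
Lemma noise_upd eps i e f :
  noise (upd eps i e) f = noise1 i e (noise (upd eps i 0) f).
Proof.
apply/funext => x; rewrite /noise1 /noise !mulr_sumr -big_split/=.
apply: eq_bigr => y _; rewrite !mulrA -mulrDl; congr (_ * _).
have offi e' x' : \prod_(j < n | j != i)
     (if y j == x' j then 1 - upd eps i e' j else upd eps i e' j) =
   \prod_(j < n | j != i) (if y j == x' j then 1 - eps j else eps j).
  by apply: eq_bigr => j ji; rewrite /upd (negbTE ji).
have offf : \prod_(j < n | j != i) (if y j == flip i x j then 1 - eps j else eps j) =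
   \prod_(j < n | j != i) (if y j == x j then 1 - eps j else eps j).
  by apply: eq_bigr => j ji; rewrite ffunE (negbTE ji).
rewrite !(bigD1 (P := xpredT) i)//= !offi offf !mulrA -mulrDl; congr (_ * _).
rewrite /upd eqxx ffunE eqxx subr0.
by case: (y i); case: (x i); rewrite /= ?mulr1 ?mulr0 ?addr0 ?add0r.
Qed.

Lemma upd_id eps i : upd eps i (eps i) = eps.
Proof. by apply/funext => j; rewrite /upd; case: eqP => // ->. Qed.

Lemma noise_cst1 eps : noise eps (fun=> 1) = fun=> 1.
Proof.
apply/funext => x; rewrite /noise.
under eq_bigr do rewrite mulr1.
rewrite -(bigA_distr_bigA (fun i (b : bool) => if b == x i then 1 - eps i else eps i)).
apply: big1 => i _; rewrite big_bool.
by case: (x i); rewrite /= ?subrK// addrC subrK.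
Qed.

Definition cond_eps T i : R := if i \in T then 0 else 2^-1.

Lemma condE_noise T f : condE T f = noise (cond_eps T) f.
Proof.
pose c : R := \prod_i (if i \in T then 1 else 2^-1).
have kerE x y : \prod_i (if y i == x i then 1 - cond_eps T i else cond_eps T i) =
    if [forall i in T, y i == x i] then c else 0.
  have [/forall_inP h|] := boolP [forall i in T, y i == x i].
    apply: eq_bigr => i _; rewrite /cond_eps.
    have [iT|_] := boolP (i \in T); first by rewrite h// subr0.
    by case: ifP => // _; field.
  rewrite negb_forall_in => /exists_inP[i iT /negbTE yx].
  by rewrite (bigD1 i)//= yx /cond_eps iT mul0r.
have noiseE g x : noise (cond_eps T) g x =
    c * \sum_(y : cube n | [forall i in T, y i == x i]) g y.
  rewrite /noise mulr_sumr [RHS]big_mkcond/=; apply: eq_bigr => y _.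
  by rewrite kerE; case: ifP; rewrite ?mul0r.
apply/funext => x; rewrite noiseE /condE; congr (_ * _).
(* Evaluating at the constant function 1 identifies [c] without counting the points that agree with
   x on T. *)
have := congr1 (fun h => h x) (noise_cst1 (cond_eps T)); rewrite noiseE sumr_const.
rewrite cardsE => h; apply: (mulIf (x := #|[pred y : cube n | [forall i in T, y i == x i]]|%:R)).
  by apply/eqP => h0; move: h; rewrite h0 mulr0 => /eqP; rewrite eq_sym oner_eq0.
rewrite h mulVf//; apply/eqP => h0.
by move: h; rewrite h0 mulr0 => /eqP; rewrite eq_sym oner_eq0.
Qed.

Lemma ErandE lam (F : {set 'I_n} -> R) :
  Erand lam F = \sum_(T : {set 'I_n}) (\prod_i (if i \in T then lam i else 1 - lam i)) * F T.
Proof.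
apply: eq_bigr => T _; congr (_ * _).
rewrite [RHS](bigID (mem T))/=; congr (_ * _).
  by apply: eq_bigr => i ->.
apply: eq_big => i; first by rewrite inE.
by rewrite inE => /negbTE ->.
Qed.

Lemma Erand_cst lam (c : R) : Erand lam (fun=> c) = c.
Proof.
rewrite ErandE -mulr_suml -bigA_distr big1 ?mul1r// => i _.
exact: (subrKC (lam i) 1).
Qed.

(** Resampling the membership of [i] does not change the law of T. The proof doubles both sums and
    pairs each T with the set obtained by toggling [i]. *)
Lemma Erand_resample lam i (F : {set 'I_n} -> R) :
  Erand lam F =
  Erand lam (fun T => lam i * F (i |: T) + (1 - lam i) * F (T :\ i)).
Proof.
pose tog T := if i \in T then T :\ i else i |: T.
have togK : involutive tog.
  move=> T; rewrite /tog; have [iT|iT] := boolP (i \in T).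
    by rewrite setD11 setD1K.
  by rewrite setU11 setU1K.
pose w T := \prod_(j | j != i) (if j \in T then lam j else 1 - lam j).
have wE T : \prod_j (if j \in T then lam j else 1 - lam j) =
    (if i \in T then lam i else 1 - lam i) * w T by rewrite (bigD1 i).
have w1 T : w (i |: T) = w T.
  by apply: eq_bigr => j ji; rewrite in_setU1 (negbTE ji).
have w0 T : w (T :\ i) = w T.
  by apply: eq_bigr => j ji; rewrite in_setD1 ji.
have togS (G : {set 'I_n} -> R) : \sum_T G (tog T) = \sum_T G T.
  by rewrite [RHS](reindex_inj (inv_inj togK)).
have dbl (G : {set 'I_n} -> R) :
    2 * \sum_(T : {set 'I_n}) G T = \sum_(T : {set 'I_n}) (G T + G (tog T)).
  by rewrite big_split/= togS mulr2n mulrDl mul1r.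
have n2 : 2 != 0 :> R by rewrite pnatr_eq0.
apply: (mulfI n2); rewrite !ErandE !dbl; apply: eq_bigr => T _.
rewrite !wE /tog; have [iT|iT] := boolP (i \in T).
  rewrite setD11 w0 (setUidPr _) ?sub1set// setD1K//.
  have -> : T :\ i :\ i = T :\ i by rewrite setDDl setUid.
  ring.
rewrite setU11 w1 setU1K// setUA setUid.
have -> : T :\ i = T by apply/setDidPl; rewrite disjoint_sym disjoints1.
ring.
Qed.

Lemma ler_Erand lam (F G : {set 'I_n} -> R) : (forall i, 0 <= lam i <= 1) ->
  (forall T, F T <= G T) -> Erand lam F <= Erand lam G.
Proof.
move=> hl FG; rewrite !ErandE; apply: ler_sum => T _.
rewrite ler_wpM2l// prodr_ge0// => i _; have /andP[l0 l1] := hl i.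
by case: ifP; rewrite ?subr_ge0.
Qed.

(** [Psi] is kept abstract to serve both norms, and its negative in the equality case. The
    one-coordinate bound is needed only for functions still noiseless at [i]. *)
Lemma noise_tensorization eps lam f (Psi : (cube n -> R) -> R) :
  (forall i, 0 <= eps i <= 2^-1) -> (forall i, 0 <= lam i <= 1) ->
  (forall i eps', (forall j, 0 <= eps' j <= 2^-1) -> eps' i = 0 ->
     Psi (noise1 i (eps i) (noise eps' f)) <=
     lam i * Psi (noise eps' f)
     + (1 - lam i) * Psi (noise1 i 2^-1 (noise eps' f))) ->
  Psi (noise eps f) <= Erand lam (fun T => Psi (condE T f)).
Proof.
move=> heps hlam step.
have h2 : 0 <= 2^-1 :> R by rewrite invr_ge0 ler0n.
(* In the hybrid, the first k coordinates already carry parameter 0 or 1/2 according to T; the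
   others keep [eps]. *)
pose hyb k T i := if (i < k)%N then cond_eps T i else eps i.
suff: forall k, (k <= n)%N ->
    Psi (noise eps f) <= Erand lam (fun T => Psi (noise (hyb k T) f)).
  move=> /(_ n (leqnn n)) /le_trans; apply; rewrite le_eqVlt; apply/orP; left.
  apply/eqP; congr Erand; apply/funext => T; rewrite condE_noise; congr (Psi (noise _ f)).
  by apply/funext => i; rewrite /hyb ltn_ord.
elim=> [_|k IH kn]; first by rewrite -{1}[Psi _](Erand_cst lam).
apply: le_trans (IH (ltnW kn)) _.
pose i := Ordinal kn.
(* Only the right side is resampled: [hyb k T] has parameter [eps i] at [i] whether or not [i] lies
   in T. *)
rewrite [leRHS](Erand_resample _ i); apply: ler_Erand => // T.
have hybi T' (T'' : {set 'I_n}) (d : R) : d = cond_eps T'' i ->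
   (forall j, j != i -> (j \in T'') = (j \in T')) -> hyb k.+1 T'' = upd (hyb k T') i d.
  move=> -> hT; apply/funext => j; rewrite /hyb /upd; have [->|ji] := eqVneq j i.
    by rewrite ltnS leqnn.
  by rewrite ltnS leq_eqVlt -[_ == k]/(j == i) (negbTE ji)/= /cond_eps hT.
rewrite (hybi T (i |: T) 0); last 2 first.
- by rewrite /cond_eps setU11.
- by move=> j ji; rewrite in_setU1 (negbTE ji).
rewrite (hybi T (T :\ i) 2^-1); last 2 first.
- by rewrite /cond_eps setD11.
- by move=> j ji; rewrite in_setD1 ji.
have -> : hyb k T = upd (hyb k T) i (eps i).
  by rewrite -[LHS](upd_id _ i) /hyb ltnn.
rewrite (noise_upd _ _ (eps i)) (noise_upd _ _ 2^-1).
have updi d e' : upd (upd (hyb k T) i d) i e' = upd (hyb k T) i e'.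
  by apply/funext => j; rewrite /upd; case: eqP.
rewrite !updi; apply: step; last by rewrite /upd eqxx.
move=> j; rewrite /upd /hyb /cond_eps; do ![case: ifP => // _]; rewrite ?lexx ?h2//.
Qed.

End Cube.

(** * One-coordinate inequalities for the two norms *)

Section Norms.
Set Implicit Arguments.
Unset Strict Implicit.
Context {R : realType} {n : nat}.
Implicit Types (eps lam : 'I_n -> R) (f g : cube n -> R) (x y : cube n).
Implicit Types (i j : 'I_n) (e c : R) (q m : nat).

(** A class preserved by noise, on which all norms are positive and so have genuine logarithms. *)
Definition nonneg_nonzero g := (forall x, 0 <= g x) /\ exists x, g x != 0.

Lemma nonneg_nonzero_gt0 g : nonneg_nonzero g -> exists x, 0 < g x.
Proof. by case=> g0 [x gx]; exists x; rewrite lt0r gx g0. Qed.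

(** Parameters at most 1/2 make the kernel positive on the diagonal, so the noisy function is
    positive wherever [f] is. *)
Lemma nonneg_nonzero_noise eps f : (forall i, 0 <= eps i <= 2^-1) ->
  nonneg_nonzero f -> nonneg_nonzero (noise eps f).
Proof.
move=> heps hf; have [f0 _] := hf.
have k0 x y : 0 <= \prod_i (if y i == x i then 1 - eps i else eps i).
  by apply: prodr_ge0 => i _; have := heps i; case: ifP => _; lra.
split=> [x|]; first by apply: sumr_ge0 => y _; rewrite mulr_ge0.
have [x fx] := nonneg_nonzero_gt0 hf; exists x.
rewrite gt_eqF// /noise (bigD1 x)//= ltr_pwDl ?sumr_ge0// => [|y _]; last first.
  by rewrite mulr_ge0.
by rewrite mulr_gt0// prodr_gt0// => i _; rewrite eqxx; have := heps i; lra.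
Qed.

Lemma noise1E i e g x :
  noise1 i e g x = (1 - 2 * e) * g x + 2 * e * noise1 i 2^-1 g x.
Proof. by rewrite /noise1; field. Qed.

Lemma nonneg_nonzero_noise1 i e g : 0 <= e <= 2^-1 ->
  nonneg_nonzero g -> nonneg_nonzero (noise1 i e g).
Proof.
move=> /andP[e0 e1] hg; have [g0 _] := hg; split=> [x|].
  by rewrite addr_ge0// mulr_ge0//; lra.
have [x gx] := nonneg_nonzero_gt0 hg; exists x.
by rewrite gt_eqF// ltr_pwDl ?mulr_ge0// mulr_gt0//; lra.
Qed.

Lemma sum_exp_gt0 g q : nonneg_nonzero g -> 0 < \sum_x g x ^+ q.
Proof.
move=> hg; have [g0 _] := hg; have [x gx] := nonneg_nonzero_gt0 hg.
by rewrite (bigD1 x)//= ltr_pwDl ?exprn_gt0// sumr_ge0// => y _; rewrite exprn_ge0.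
Qed.

Lemma ln_qnorm g q : nonneg_nonzero g ->
  ln (qnorm q g) = q%:R^-1 * (ln (\sum_x g x ^+ q) - ln #|{: cube n}|%:R).
Proof.
move=> hg; have [g0 [x0 _]] := hg; rewrite /qnorm ln_powR /Eu; congr (_ * _).
have c0 : 0 < #|{: cube n}|%:R :> R by rewrite ltr0n; apply/card_gt0P; exists x0.
rewrite (eq_bigr (fun x => g x ^+ q)) => [|x _]; last by rewrite ger0_norm.
by rewrite lnM ?posrE ?invr_gt0 ?sum_exp_gt0// lnV ?posrE// addrC.
Qed.

Lemma half_bounds : 0 <= (2^-1 : R) <= 2^-1.
Proof. by rewrite invr_ge0 ler0n lexx. Qed.

Lemma ln_qnorm_noise1 m i e g : 0 <= e <= 2^-1 -> nonneg_nonzero g ->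
  ln (qnorm m.+2 (noise1 i e g)) <=
  lam_q m.+2 e * ln (qnorm m.+2 g)
  + (1 - lam_q m.+2 e) * ln (qnorm m.+2 (noise1 i 2^-1 g)).
Proof.
move=> he hg; have [g0 _] := hg.
have h2 := half_bounds.
have hge := nonneg_nonzero_noise1 i he hg.
have hgh := nonneg_nonzero_noise1 i h2 hg.
have [ge0 _] := hge; have [gh0 _] := hgh.
rewrite !ln_qnorm//.
(* Summing over all x counts each pair twice; the resulting ln 2 cancels at the end because the
   exponents add up to 1. *)
have dbl (h : cube n -> R) : \sum_x (h x ^+ m.+2 + h (flip i x) ^+ m.+2) = 2 * \sum_x h x ^+ m.+2.
  by rewrite big_split/= (sum_flip i (fun x => h x ^+ m.+2)); ring.
have S0 := sum_exp_gt0 m.+2 hge; have A0 := sum_exp_gt0 m.+2 hg.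
have B0 := sum_exp_gt0 m.+2 hgh.
have := @ln_sum_holder _ _ (fun x => noise1 i e g x ^+ m.+2 + noise1 i e g (flip i x) ^+ m.+2)
  (fun x => g x ^+ m.+2 + g (flip i x) ^+ m.+2)
  (fun x => 2 * noise1 i 2^-1 g x ^+ m.+2) _ (lam_q01 m he).
rewrite !dbl -mulr_sumr !lnM ?posrE// => h.
suff : ln (\sum_x noise1 i e g x ^+ m.+2) <=
    lam_q m.+2 e * ln (\sum_x g x ^+ m.+2) +
    (1 - lam_q m.+2 e) * ln (\sum_x noise1 i 2^-1 g x ^+ m.+2).
  move=> hS; set l := lam_q _ _ in hS *.
  rewrite [leRHS](_ : _ = m.+2%:R^-1 * (l * ln (\sum_x g x ^+ m.+2) +
    (1 - l) * ln (\sum_x noise1 i 2^-1 g x ^+ m.+2) - ln #|{: cube n}|%:R)); last by ring.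
  by rewrite ler_wpM2l ?invr_ge0// lerD2r.
have {h} : ln 2 + ln (\sum_x noise1 i e g x ^+ m.+2) <=
    lam_q m.+2 e * (ln 2 + ln (\sum_x g x ^+ m.+2)) +
    (1 - lam_q m.+2 e) * (ln 2 + ln (\sum_x noise1 i 2^-1 g x ^+ m.+2)).
  apply: h => [x|x|x|x|]; last by rewrite mulr_gt0.
  - by rewrite addr_ge0 ?exprn_ge0.
  - by rewrite addr_ge0 ?exprn_ge0.
  - by rewrite mulr_ge0 ?exprn_ge0.
  have flipE : noise1 i e g (flip i x) = (1 - e) * g (flip i x) + e * g x.
    by rewrite /noise1 flipK.
  have halfE : noise1 i 2^-1 g x = (g x + g (flip i x)) / 2.
    by rewrite /noise1; field.
  rewrite flipE halfE {1}/noise1 => L0.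
  have xy : 0 < g x + g (flip i x).
    rewrite lt0r addr_ge0// andbT paddr_eq0//; apply: contraTN L0 => /andP[/eqP -> /eqP ->].
    by rewrite !mulr0 addr0 expr0n addr0 ltxx.
  split; last by apply: ln_two_point.
  - move: xy; rewrite !lt0r !paddr_eq0 ?exprn_ge0// !expf_eq0/= => /andP[-> _].
    by rewrite addr_ge0 ?exprn_ge0.
  - by rewrite mulr_gt0// exprn_gt0// divr_gt0.
lra.
Qed.

Lemma infnorm_ub g x : g x <= infnorm g.
Proof. by rewrite (le_trans (ler_norm _))// /infnorm; apply: le_bigmax_cond. Qed.

Lemma infnorm_le g c : (forall x, 0 <= g x <= c) -> 0 <= c -> infnorm g <= c.
Proof.
move=> gc c0; apply: bigmax_le => // x _; have /andP[gx gxc] := gc x.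
by rewrite ger0_norm.
Qed.

Lemma infnorm_gt0 g : nonneg_nonzero g -> 0 < infnorm g.
Proof. by move=> /nonneg_nonzero_gt0[x gx]; exact: lt_le_trans (infnorm_ub g x). Qed.

Lemma ln_infnorm_noise1 i e g : 0 <= e <= 2^-1 -> nonneg_nonzero g ->
  ln (infnorm (noise1 i e g)) <=
  lam_inf e * ln (infnorm g) + (1 - lam_inf e) * ln (infnorm (noise1 i 2^-1 g)).
Proof.
move=> he hg; have [g0 _] := hg; have /andP[e0 e1] := he.
have h2 := half_bounds.
have hge := nonneg_nonzero_noise1 i he hg.
have hgh := nonneg_nonzero_noise1 i h2 hg.
have [ge0 _] := hge; have [gh0 _] := hgh.
have M0 := infnorm_gt0 hg; have N0 := infnorm_gt0 hgh.
(* Averaging a nonnegative function over pairs at most halves its maximum, so M/N lies in [1, 2]. *)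
have MN : infnorm (noise1 i 2^-1 g) <= infnorm g <= 2 * infnorm (noise1 i 2^-1 g).
  apply/andP; split; apply: infnorm_le; rewrite ?mulr_ge0 ?(ltW M0) ?(ltW N0)// => x.
    rewrite gh0/= /noise1; have := infnorm_ub g x; have := infnorm_ub g (flip i x); lra.
  rewrite g0/=; have := infnorm_ub (noise1 i 2^-1 g) x.
  by have := g0 (flip i x); rewrite {1}/noise1; lra.
apply: le_trans (ln_interp_le he N0 MN).
have b0 : 0 < (1 - 2 * e) * infnorm g + 2 * e * infnorm (noise1 i 2^-1 g).
  by move: MN => /andP[? ?]; nra.
rewrite ler_ln ?posrE ?infnorm_gt0//; apply: infnorm_le (ltW b0) => x.
rewrite ge0/= noise1E lerD// ler_wpM2l ?infnorm_ub ?mulr_ge0//; lra.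
Qed.

(** * Equality for indicators of subcubes *)

Definition flip_disjoint i g := forall x, g x = 0 \/ g (flip i x) = 0.

Lemma sum_exp_noise1_disjoint i e g q : flip_disjoint i g ->
  \sum_x noise1 i e g x ^+ q.+1 = (e ^+ q.+1 + (1 - e) ^+ q.+1) * \sum_x g x ^+ q.+1.
Proof.
move=> gi; have n2 : 2 != 0 :> R by rewrite pnatr_eq0.
apply: (mulfI n2); rewrite mulrCA.
have dbl (h : cube n -> R) :
    2 * \sum_x h x ^+ q.+1 = \sum_x (h x ^+ q.+1 + h (flip i x) ^+ q.+1) :> R.
  by rewrite big_split/= (sum_flip i (fun x => h x ^+ q.+1)); ring.
rewrite !dbl mulr_sumr; apply: eq_bigr => x _; rewrite /noise1 flipK.
case: (gi x) => ->; rewrite !mulr0 ?add0r ?addr0 !exprMn expr0n/= ?add0r ?addr0; ring.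
Qed.

(** Each pair has at most one nonzero value: this is the endpoint u = 1 of the two-point bound,
    where both sides agree. *)
Lemma ln_qnorm_noise1_disjoint m i e g : 0 <= e <= 2^-1 -> nonneg_nonzero g ->
  flip_disjoint i g ->
  ln (qnorm m.+2 (noise1 i e g)) =
  lam_q m.+2 e * ln (qnorm m.+2 g)
  + (1 - lam_q m.+2 e) * ln (qnorm m.+2 (noise1 i 2^-1 g)).
Proof.
move=> he hg gi; have /andP[e0 e1] := he.
have h2 := half_bounds.
rewrite !ln_qnorm//; try exact: nonneg_nonzero_noise1.
rewrite !sum_exp_noise1_disjoint//.
have A0 := sum_exp_gt0 m.+2 hg.
have s0 : 0 < e ^+ m.+2 + (1 - e) ^+ m.+2.
  by rewrite ltr_wpDl ?exprn_ge0 ?exprn_gt0//; lra.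
(* By the choice of [lam_q], the factor for e is the power 1 - [lam_q] of this factor for 1/2. *)
have -> : 2^-1 ^+ m.+2 + (1 - 2^-1) ^+ m.+2 = (2 ^+ m.+1)^-1 :> R.
  have -> : 1 - 2^-1 = 2^-1 :> R by field.
  by rewrite exprVn (exprS _ m.+1); field; rewrite expf_neq0// pnatr_eq0.
have p0 : 0 < 2 ^+ m.+1 :> R by rewrite exprn_gt0.
rewrite [ln (_ ^-1 * _)]lnM ?posrE ?invr_gt0// lnV ?posrE// lnXn// -[ln 2 *+ _]mulr_natl.
rewrite lnM ?posrE// /lam_q /log2.
have n3 : ln 2 != 0 :> R by rewrite gt_eqF ?ln_gt0 ?ltr1n.
rewrite [m.+2.-1]/=; field; rewrite -natrD nat1r !pnatr_eq0. by rewrite n3.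
Qed.

(** At each x only one of the two terms survives, with weight e or 1 - e, and 1 - e is the
    larger. *)
Lemma infnorm_noise1_disjoint i e g : 0 <= e <= 2^-1 -> nonneg_nonzero g ->
  flip_disjoint i g -> infnorm (noise1 i e g) = (1 - e) * infnorm g.
Proof.
move=> he hg gi; have /andP[e0 e1] := he; have [g0 _] := hg.
have [ge0 _] := nonneg_nonzero_noise1 i he hg.
apply/eqP; rewrite eq_le; apply/andP; split.
  apply: infnorm_le => [x|]; last by rewrite mulr_ge0 ?(ltW (infnorm_gt0 hg))//; lra.
  rewrite ge0/= /noise1; have := infnorm_ub g x; have := infnorm_ub g (flip i x).
  by have := ltW (infnorm_gt0 hg); case: (gi x) => ->; rewrite mulr0 ?addr0 ?add0r; nra.
have e2 : 0 < 1 - e by lra.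
rewrite mulrC -ler_pdivlMr//; apply: infnorm_le => [x|].
  rewrite g0/= ler_pdivlMr// mulrC (le_trans _ (infnorm_ub _ x))//.
  by rewrite lerDl mulr_ge0.
by rewrite divr_ge0// ltW// infnorm_gt0//; exact: nonneg_nonzero_noise1.
Qed.

Lemma ln_infnorm_noise1_disjoint i e g : 0 <= e <= 2^-1 -> nonneg_nonzero g ->
  flip_disjoint i g ->
  ln (infnorm (noise1 i e g)) =
  lam_inf e * ln (infnorm g) + (1 - lam_inf e) * ln (infnorm (noise1 i 2^-1 g)).
Proof.
move=> he hg gi; have /andP[e0 e1] := he.
have h2 := half_bounds.
have M0 := infnorm_gt0 hg.
rewrite !infnorm_noise1_disjoint//.
have -> : 1 - 2^-1 = 2^-1 :> R by field.
rewrite !lnM ?posrE ?invr_gt0//; last lra.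
rewrite lnV ?posrE// /lam_inf /log2.
by field; rewrite gt_eqF ?ln_gt0 ?ltr1n.
Qed.

Lemma noise1_flip_invariant i e g : (forall x, g (flip i x) = g x) ->
  noise1 i e g = g.
Proof. by move=> gi; apply/funext => x; rewrite /noise1 gi; ring. Qed.

Lemma nonneg_nonzero_subcube (K : {set 'I_n}) (a : cube n) :
  nonneg_nonzero (subcube_ind R K a).
Proof.
rewrite /subcube_ind; split=> [x|]; first by case: ifP.
by exists a; rewrite (_ : [forall i in K, a i == a i])// ?oner_eq0//; apply/forall_inP.
Qed.

(** Without noise at [i], the constraint at [i] that defines the subcube survives. *)
Lemma noise_subcube_disjoint (K : {set 'I_n}) a eps i : i \in K -> eps i = 0 ->
  flip_disjoint i (noise eps (subcube_ind R K a)).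
Proof.
move=> iK ei x.
suff h y : y i != a i -> noise eps (subcube_ind R K a) y = 0.
  have [xa|/h] := eqVneq (x i) (a i); last by left.
  by right; apply: h; rewrite ffunE eqxx xa; case: (a i).
move=> ya; rewrite /noise big1// => z _; rewrite (bigD1 i)//= ei.
have [zy|_] := eqVneq (z i) (y i); last by rewrite !mul0r.
rewrite /subcube_ind ifF ?mulr0//; apply/negP => /forall_inP/(_ i iK).
by rewrite zy (negbTE ya).
Qed.

(** The kernel does not change when both points are flipped at [i], and the indicator ignores that
    coordinate. *)
Lemma noise_subcube_invariant (K : {set 'I_n}) a eps i x : i \notin K ->
  noise eps (subcube_ind R K a) (flip i x) = noise eps (subcube_ind R K a) x.
Proof.
move=> iK; rewrite /noise (reindex_inj (inv_inj (flipK i)))/=.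
apply: eq_bigr => y _; congr (_ * _).
  apply: eq_bigr => j _; rewrite !ffunE.
  by have [->|_] := eqVneq j i; [case: (y i); case: (x i)|].
rewrite /subcube_ind; congr (if _ then _ else _).
apply: eq_forallb_in => j jK; rewrite ffunE.
by have [ji|//] := eqVneq j i; move: iK; rewrite -ji jK.
Qed.

(** If [i] is not in [K], all three functions coincide and the identity holds for every [l]. *)
Lemma noise1_subcube (Psi : (cube n -> R) -> R) (l : R) (K : {set 'I_n}) a eps i e :
  eps i = 0 ->
  (flip_disjoint i (noise eps (subcube_ind R K a)) ->
    Psi (noise1 i e (noise eps (subcube_ind R K a))) =
    l * Psi (noise eps (subcube_ind R K a))
    + (1 - l) * Psi (noise1 i 2^-1 (noise eps (subcube_ind R K a)))) ->
  Psi (noise1 i e (noise eps (subcube_ind R K a))) =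
    l * Psi (noise eps (subcube_ind R K a))
    + (1 - l) * Psi (noise1 i 2^-1 (noise eps (subcube_ind R K a))).
Proof.
move=> ei h; have [iK|iK] := boolP (i \in K); first exact/h/noise_subcube_disjoint.
have inv := fun x => noise_subcube_invariant a eps x iK.
by rewrite !noise1_flip_invariant//; ring.
Qed.

(** Obtained from [noise_tensorization] for [Psi] and for its negative. *)
Lemma noise_tensorization_eq eps lam f (Psi : (cube n -> R) -> R) :
  (forall i, 0 <= eps i <= 2^-1) -> (forall i, 0 <= lam i <= 1) ->
  (forall i eps', (forall j, 0 <= eps' j <= 2^-1) -> eps' i = 0 ->
     Psi (noise1 i (eps i) (noise eps' f)) =
     lam i * Psi (noise eps' f)
     + (1 - lam i) * Psi (noise1 i 2^-1 (noise eps' f))) ->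
  Psi (noise eps f) = Erand lam (fun T => Psi (condE T f)).
Proof.
move=> heps hlam step; apply/eqP; rewrite eq_le; apply/andP; split.
  by apply: noise_tensorization => // i eps' h1 h2; rewrite step.
rewrite -lerN2 [leRHS](_ : _ = Erand lam (fun T => - Psi (condE T f))); last first.
  by rewrite /Erand -sumrN; apply: eq_bigr => T _; rewrite mulrN.
apply: (noise_tensorization (Psi := fun g => - Psi g)) => // i eps' h1 h2.
by rewrite step// !mulrN -opprD.
Qed.

End Norms.

Theorem theorem2p1 (R : realType) (n : nat) (eps : 'I_n -> R) :
  (0 < n)%N ->
  (forall i, 0 <= eps i <= 2^-1) ->
  (* (i) and (ii) *)
  (forall f : cube n -> R,
     (forall x, 0 <= f x) -> (exists x, f x != 0) ->
     (forall q : nat, (2 <= q)%N ->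
        ln (qnorm q (noise eps f))
        <= Erand (fun i => lam_q q (eps i)) (fun T => ln (qnorm q (condE T f))))
     /\
     ln (infnorm (noise eps f))
     <= Erand (fun i => lam_inf (eps i)) (fun T => ln (infnorm (condE T f)))) /\
  (* (iii) equality for indicators of subcubes *)
  (forall (K : {set 'I_n}) (a : cube n),
     let f := subcube_ind R K a in
     (forall q : nat, (2 <= q)%N ->
        ln (qnorm q (noise eps f))
        = Erand (fun i => lam_q q (eps i)) (fun T => ln (qnorm q (condE T f))))
     /\
     ln (infnorm (noise eps f))
     = Erand (fun i => lam_inf (eps i)) (fun T => ln (infnorm (condE T f)))).
Proof.
move=> _ heps; split=> [f f0 fn0|K a f].
  have hf : nonneg_nonzero f by [].
  split=> [[|[|m]]// _|].
    apply: (noise_tensorization (Psi := fun g => ln (qnorm m.+2 g))) => // [i|i eps' heps' _].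
      exact: lam_q01.
    by apply: ln_qnorm_noise1 => //; exact: nonneg_nonzero_noise.
  apply: (noise_tensorization (Psi := fun g => ln (infnorm g))) => // [i|i eps' heps' _].
    exact: lam_inf01.
  by apply: ln_infnorm_noise1 => //; exact: nonneg_nonzero_noise.
have hf : nonneg_nonzero f by exact: nonneg_nonzero_subcube.
split=> [[|[|m]]// _|].
  apply: (noise_tensorization_eq (Psi := fun g => ln (qnorm m.+2 g))) => // [i|i eps' heps' ei].
    exact: lam_q01.
  apply: (noise1_subcube (Psi := fun g => ln (qnorm m.+2 g))) => //.
  by apply: ln_qnorm_noise1_disjoint => //; exact: nonneg_nonzero_noise.
apply: (noise_tensorization_eq (Psi := fun g => ln (infnorm g))) => // [i|i eps' heps' ei].
  exact: lam_inf01.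
apply: (noise1_subcube (Psi := fun g => ln (infnorm g))) => //.
by apply: ln_infnorm_noise1_disjoint => //; exact: nonneg_nonzero_noise.
Qed.
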